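(* Let $\mathcal{F}$ be a transitive projective Fraisse category with projective Fraisse limit $\mathbb{F}$, let $F=\mathbb{F}/R^{\mathbb{F}}$ be the quotient space, and let $\Phi:\mathrm{Aut}(\mathbb{F})\to\mathrm{Homeo}(F)$ be the map induced by the quotient map. Then $\mathcal{F}$ has the approximate Ramsey property if and only if the closed subgroup $\overline{\Phi[\mathrm{Aut}(\mathbb{F})]}$ of $\mathrm{Homeo}(F)$ (closure taken in $\mathrm{Homeo}(F)$, with the subspace topology) is extremely amenable.
   Context: All spaces are Hausdorff; $\mathbb{N}=\{0,1,2,\ldots\}$. **Structures and morphisms.** A graph $(A,R^A)$ is a set with a reflexive symmetric binary relation. Let $\mathcal{L}$ be a language containing a special binary relation symbol $R$. A morphism $f:B\to A$ of $\mathcal{L}$-structures preserves relations ($S^B(b_1,\ldots,b_m)\Rightarrow S^A(f(b_1),\ldots,f(b_m))$) and commutes with function symbols. It is a surjective morphism if it is surjective as a map and whenever $S^A(a_1,\ldots,a_m)$ for a relation symbol $S$, there are $b_i$ with $f(b_i)=a_i$ and $S^B(b_1,\ldots,b_m)$. **Projective Fraisse category.** A category $\mathcal{F}$ of $\mathcal{L}$-structures and surjective morphisms such that: (i) for each $A\in\mathcal{F}$, $(A,R^A)$ is a finite graph; (ii) there are countably many structures in $\mathcal{F}$ up to isomorphism; (iii) for any $A,B\in\mathcal{F}$ there are $C\in\mathcal{F}$ and morphisms $C\to A$, $C\to B$ in $\mathcal{F}$; (iv) for any morphisms $f:B\to A$, $g:C\to A$ in $\mathcal{F}$ there are $D\in\mathcal{F}$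 and morphisms $f':D\to B$, $g':D\to C$ in $\mathcal{F}$ with $f\circ f'=g\circ g'$. $\mathrm{Epi}(B,A)$ is the set of all morphisms $B\to A$ in $\mathcal{F}$. **Limits.** $\mathcal{F}^\omega$ has as objects inverse limits $\mathbb{L}=\varprojlim(A_n,f_n^{n+1})_{n\in\mathbb{N}}$ with $A_n\in\mathcal{F}$ and $f_n^{n+1}:A_{n+1}\to A_n$ in $\mathcal{F}$; $\pi_n^{\mathbb{L}}:\mathbb{L}\to A_n$ are the projections. A morphism $h:\mathbb{L}=\varprojlim(A_n,f_n^{n+1})\to\mathbb{M}=\varprojlim(B_n,g_n^{n+1})$ is a map for which there are $i_0<i_1<\cdots$ and morphisms $h_n:A_{i_n}\to B_n$ in $\mathcal{F}$ with $\pi_n^{\mathbb{M}}\circ h=h_n\circ\pi_{i_n}^{\mathbb{L}}$ for all $n$; it is an isomorphism if it is bijective and $h^{-1}$ is a morphism. $\mathcal{F}$ is viewed inside $\mathcal{F}^\omega$ via constant sequences. Each $\mathbb{L}$ is topologized as a subspace of $\prod_n A_n$ (each $A_n$ discrete) and carries the $\mathcal{L}$-structure defined coordinatewise; in particular $xR^{\mathbb{L}}y$ iff $\pi_n^{\mathbb L}(x)R^{A_n}\pi_n^{\mathbb L}(y)$ for all $n$. The projective Fraisse limit of $\mathcal{F}$ is the unique up to isomorphism $\mathbb{F}\in\mathcal{F}^\omega$ such that (i) for each $A\in\mathcal{F}$ there is a morphism $\mathbb{F}\to A$; (ii) for all $A,B\in\mathcal{F}$ and morphisms $f:\mathbb{F}\to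 A$, $g:B\to A$, there is a morphism $h:\mathbb{F}\to B$ with $g\circ h=f$. $\mathcal{F}$ is transitive if $R^{\mathbb{F}}$ is a transitive relation; then $R^{\mathbb{F}}$ is a compact equivalence relation and $F=\mathbb{F}/R^{\mathbb{F}}$ with the quotient topology is compact metrizable; $q:\mathbb{F}\to F$ is the quotient map. **Groups.** $\mathrm{Aut}(\mathbb{F})$ is the group of isomorphisms $\mathbb{F}\to\mathbb{F}$ in $\mathcal{F}^\omega$. $\mathrm{Homeo}(F)$ is the group of homeomorphisms of $F$ with the uniform convergence topology. $\Phi$ is given by $\Phi(f)(q(x))=q(f(x))$. **Approximate Ramsey property.** For $A\in\mathcal{F}$, $d_A$ is the graph metric: $d_A(a,a)=0$, and for $a\ne b$, $d_A(a,b)$ is the least $l$ such that there are $a=a_0,a_1,\ldots,a_l=b$ with $a_iR^Aa_{i+1}$ for $i<l$ ($\infty$ if there is none). For $f,g\in\mathrm{Epi}(B,A)$, $d_{\mathrm{Epi}(B,A)}(f,g)=\sup_{b\in B}d_A(f(b),g(b))$. For $X\subseteq\mathrm{Epi}(C,A)$, $[X]_1=\{g\in\mathrm{Epi}(C,A):\exists f\in X\ d_{\mathrm{Epi}(C,A)}(f,g)\le1\}$. $\mathcal{F}$ has the approximate Ramsey property if for all $A,B\in\mathcal{F}$ and $d\in\mathbb{N}$ there is $C\in\mathcal{F}$ such that for every $\chi:\mathrm{Epi}(C,A)\to\{1,\ldots,d\}$ there are $f\in\mathrm{Epi}(C,B)$ and $1\le i\le d$ with $\mathrm{Epi}(B,A)\circ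 f\subseteq[\chi^{-1}(i)]_1$, where $\mathrm{Epi}(B,A)\circ f=\{h\circ f:h\in\mathrm{Epi}(B,A)\}$. **Dynamics.** A $G$-flow is a compact space with a continuous action of the topological group $G$; it is minimal if every orbit is dense. The universal minimal flow $\mathcal{M}(G)$ is the unique up to isomorphism minimal $G$-flow that admits a continuous equivariant surjection onto every minimal $G$-flow. $G$ is extremely amenable if $\mathcal{M}(G)$ is a single point. *)

(* Defs.v *)
From HB Require Import structures.
From mathcomp Require Import all_boot all_order all_algebra.
From mathcomp Require Import all_classical all_reals.
From mathcomp Require Import topology.

Set Implicit Arguments.
Unset Strict Implicit.
Unset Printing Implicit Defensive.

Local Open Scope classical_set_scope.
Local Open Scope quotient_scope.

(* The relation symbols are the special binary symbol R, encoded as [None],   *)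
(* and the other ones, so that [rel_arity None] reduces to 2.                 *)
Record language := Language {
  other_rel : Type;
  other_arity : other_rel -> nat;
  fun_symb : Type;
  fun_arity : fun_symb -> nat }.

Definition rel_symb (L : language) := option (other_rel L).

Definition rel_arity (L : language) (s : rel_symb L) : nat :=
  if s is Some r then other_arity r else 2.

Record structure (L : language) (A : Type) := Structure {
  rel_interp : forall s : rel_symb L, (rel_arity s).-tuple A -> Prop;
  fun_interp : forall s : fun_symb L, (fun_arity s).-tuple A -> A }.

Definition adj (L : language) (A : Type) (S : structure L A) (a b : A) : Prop :=
  @rel_interp L A S None [tuple a; b].

Definition is_graph (L : language) (A : Type) (S : structure L A) : Prop :=
  (forall a, adj S a a) /\ (forall a b, adj S a b -> adj S b a).

Definition is_morphism (L : language) (B A : Type)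
    (SB : structure L B) (SA : structure L A) (f : B -> A) : Prop :=
  (forall (s : rel_symb L) (t : (rel_arity s).-tuple B),
     rel_interp SB t -> rel_interp SA (map_tuple f t)) /\
  (forall (s : fun_symb L) (t : (fun_arity s).-tuple B),
     f (fun_interp SB t) = fun_interp SA (map_tuple f t)).

Definition is_surjective_morphism (L : language) (B A : Type)
    (SB : structure L B) (SA : structure L A) (f : B -> A) : Prop :=
  [/\ is_morphism SB SA f,
      forall a, exists b, f b = a &
      forall (s : rel_symb L) (t : (rel_arity s).-tuple A),
        rel_interp SA t -> exists2 u, map_tuple f u = t & rel_interp SB u].

(* The objects are indexed by an arbitrary type; the hom-sets are arbitrary   *)
(* families of surjective morphisms closed under identities and composition.  *)
Record fraisse_category (L : language) := FraisseCategory {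
  obj : Type;
  carrier : obj -> finType;
  str : forall A : obj, structure L (carrier A);
  mor : forall B A : obj, (carrier B -> carrier A) -> Prop;
  mor_id : forall A : obj, @mor A A id;
  mor_comp : forall (C B A : obj) (f : carrier B -> carrier A)
      (g : carrier C -> carrier B), mor f -> mor g -> mor (f \o g);
  mor_surjective : forall (B A : obj) (f : carrier B -> carrier A),
    mor f -> is_surjective_morphism (str B) (str A) f;
  obj_graph : forall A : obj, is_graph (str A);
  obj_countable : exists2 S : set obj, countable S &
    forall A : obj, exists2 B, S B &
      exists (f : carrier A -> carrier B) (g : carrier B -> carrier A),
        [/\ mor f, mor g, cancel f g & cancel g f];
  joint_projection : forall A B : obj,
    exists (C : obj) (f : carrier C -> carrier A) (g : carrier C -> carrier B),
      mor f /\ mor g;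
  amalgamation : forall (A B C : obj) (f : carrier B -> carrier A)
      (g : carrier C -> carrier A), mor f -> mor g ->
    exists (D : obj) (f' : carrier D -> carrier B) (g' : carrier D -> carrier C),
      [/\ mor f', mor g' & f \o f' = g \o g'] }.

Coercion carrier : obj >-> Finite.type.

Section InverseLimits.
Context (L : language) (F : fraisse_category L).

Record inv_seq := InvSeq {
  level : nat -> obj F;
  bond : forall n, level n.+1 -> level n;
  bond_mor : forall n, mor (@bond n) }.

Definition threads (X : inv_seq) :
    set (prod_topology (fun n => discrete_topology (level X n))) :=
  [set x | forall n, @bond X n (x n.+1) = x n].

Definition ilim (X : inv_seq) : topologicalType := set_type (@threads X).

Definition lim_proj (X : inv_seq) (n : nat) (x : ilim X) : level X n := set_val x n.

Lemma lim_projP (X : inv_seq) (x : ilim X) (n : nat) :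
  bond (lim_proj n.+1 x) = lim_proj n x.
Proof. by case: x => x /= xP; move/set_mem: (xP) => /(_ n). Qed.

Lemma ilim_eq (X : inv_seq) (x y : ilim X) :
  (forall n, lim_proj n x = lim_proj n y) -> x = y.
Proof. by move=> xy; apply/val_inj/functional_extensionality_dep. Qed.

Lemma ilim_fun_subproof (X : inv_seq) (s : fun_symb L)
    (t : (fun_arity s).-tuple (ilim X)) :
  (fun n => fun_interp (str (level X n)) (map_tuple (lim_proj n) t))
    \in @threads X.
Proof.
apply/mem_set => n.
have [[_ ->] _ _] := mor_surjective (bond_mor X n).
congr fun_interp; apply: val_inj => /=; rewrite -map_comp.
by apply: eq_map => x /=; rewrite lim_projP.
Qed.

Definition ilim_str (X : inv_seq) : structure L (ilim X) := {|
  rel_interp := fun s t =>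
    forall n, rel_interp (str (level X n)) (map_tuple (lim_proj n) t);
  fun_interp := fun s t => exist (fun x => x \in @threads X) _ (ilim_fun_subproof t) |}.

Lemma adj_ilimE (X : inv_seq) (x y : ilim X) :
  adj (ilim_str X) x y <->
  forall n, adj (str (level X n)) (lim_proj n x) (lim_proj n y).
Proof.
have E n : map_tuple (lim_proj n) [tuple x; y] = [tuple lim_proj n x; lim_proj n y].
  exact: val_inj.
by split=> xy n; move: (xy n); rewrite /adj E.
Qed.

Definition ilim_mor (X Y : inv_seq) (h : ilim X -> ilim Y) : Prop :=
  exists (i : nat -> nat) (hn : forall n, level X (i n) -> level Y n),
    [/\ forall n, i n < i n.+1,
        forall n, mor (@hn n) &
        forall n x, lim_proj n (h x) = hn n (lim_proj (i n) x)].

Definition const_seq (A : obj F) : inv_seq :=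
  @InvSeq (fun=> A) (fun=> id) (fun=> mor_id A).

Lemma const_thread_subproof (A : obj F) (a : A) :
  (fun=> a) \in @threads (const_seq A).
Proof. exact/mem_set. Qed.

Definition const_thread (A : obj F) (a : A) : ilim (const_seq A) :=
  exist (fun x => x \in @threads (const_seq A)) _ (const_thread_subproof a).

(* Morphisms of the category of limits from X to an object A, the latter      *)
(* being identified with the limit of its constant sequence.                  *)
Definition ilim_mor_obj (X : inv_seq) (A : obj F) (h : ilim X -> A) : Prop :=
  @ilim_mor X (const_seq A) (@const_thread A \o h).

Definition is_fraisse_limit (X : inv_seq) : Prop :=
  (forall A : obj F, exists h : ilim X -> A, ilim_mor_obj h) /\
  (forall (A B : obj F) (f : ilim X -> A) (g : B -> A),
     ilim_mor_obj f -> mor g ->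
     exists2 h : ilim X -> B, ilim_mor_obj h & g \o h = f).

Definition transitive_limit (X : inv_seq) : Prop :=
  forall x y z : ilim X, adj (ilim_str X) x y -> adj (ilim_str X) y z ->
    adj (ilim_str X) x z.

Record aut (X : inv_seq) := Aut {
  aut_fun :> ilim X -> ilim X;
  aut_inv : ilim X -> ilim X;
  aut_funK : cancel aut_fun aut_inv;
  aut_invK : cancel aut_inv aut_fun;
  aut_mor : ilim_mor aut_fun;
  aut_inv_mor : ilim_mor aut_inv }.

End InverseLimits.

Section GraphMetric.
Context (L : language) (F : fraisse_category L).

Definition walk (A : obj F) (a b : A) (l : nat) : Prop :=
  exists p : nat -> A, [/\ p 0 = a, p l = b &
    forall i, i < l -> adj (str A) (p i) (p i.+1)].

Definition graph_dist (A : obj F) (a b : A) : \bar int :=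
  if pselect (exists l, `[< walk a b l >]) is left w
  then (Posz (ex_minn w))%:E else +oo%E.

Record epi (B A : obj F) := Epi { epi_fun :> B -> A; epi_mor : mor epi_fun }.

Definition epi_comp (C B A : obj F) (h : epi B A) (f : epi C B) : epi C A :=
  Epi (mor_comp (epi_mor h) (epi_mor f)).

Definition epi_dist (B A : obj F) (f g : epi B A) : \bar int :=
  (\big[maxe/0]_(b : B) graph_dist (f b) (g b))%E.

Definition epi_thickening (C A : obj F) (X : set (epi C A)) : set (epi C A) :=
  [set g | exists2 f, X f & (epi_dist f g <= 1)%E].

Definition approximate_ramsey : Prop :=
  forall (A B : obj F) (d : nat), exists C : obj F,
    forall chi : epi C A -> 'I_d, exists (f : epi C B) (i : 'I_d),
      [set epi_comp h f | h in [set: epi B A]] `<=`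
      epi_thickening (chi @^-1` [set i]).

End GraphMetric.

(* Groups carrying a topology. Continuity of the group operations is not      *)
(* required by the definitions below; for [homeo T] it holds when T is        *)
(* compact Hausdorff.                                                         *)
#[short(type="groupWithTopologyType")]
HB.structure Definition GroupWithTopology := {G of Group G & Topological G}.

Section Homeo.
Context (T : topologicalType).

Record homeo := Homeo {
  homeo_fun :> T -> T;
  homeo_inv : T -> T;
  homeo_funK : cancel homeo_fun homeo_inv;
  homeo_invK : cancel homeo_inv homeo_fun;
  homeo_cont : continuous homeo_fun;
  homeo_inv_cont : continuous homeo_inv }.

Lemma homeo_eq (f g : homeo) : homeo_fun f = homeo_fun g -> f = g.
Proof.
case: f g => [f f' fK f'K cf cf'] [g g' gK g'K cg cg'] /= fg; subst g.
have e : f' = g' by apply/funext => x; rewrite -{1}[x]g'K fK.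
by subst g'; congr Homeo; exact: Prop_irrelevance.
Qed.

HB.instance Definition _ := gen_eqMixin homeo.
HB.instance Definition _ := gen_choiceMixin homeo.

Definition homeo1 : homeo :=
  @Homeo id id (fun=> erefl) (fun=> erefl) (fun=> cvg_id) (fun=> cvg_id).

Definition homeoV (f : homeo) : homeo :=
  Homeo (@homeo_invK f) (@homeo_funK f) (@homeo_inv_cont f) (@homeo_cont f).

Definition homeoM (f g : homeo) : homeo :=
  @Homeo (f \o g) (homeo_inv g \o homeo_inv f)
    (can_comp (@homeo_funK f) (@homeo_funK g))
    (can_comp (@homeo_invK g) (@homeo_invK f))
    (fun x => continuous_comp (@homeo_cont g x) (@homeo_cont f (g x)))
    (fun x => continuous_comp (@homeo_inv_cont f x)
                (@homeo_inv_cont g (homeo_inv f x))).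

Lemma homeoA : associative homeoM.
Proof. by move=> f g h; apply: homeo_eq. Qed.
Lemma homeo1M : left_id homeo1 homeoM.
Proof. by move=> f; apply: homeo_eq. Qed.
Lemma homeoM1 : right_id homeo1 homeoM.
Proof. by move=> f; apply: homeo_eq. Qed.
Lemma homeoVM : left_inverse homeo1 homeoV homeoM.
Proof. by move=> f; apply/homeo_eq/funext => x; exact: homeo_funK. Qed.
Lemma homeoMV : right_inverse homeo1 homeoV homeoM.
Proof. by move=> f; apply/homeo_eq/funext => x; exact: homeo_invK. Qed.

HB.instance Definition _ :=
  isGroup.Build homeo homeoA homeo1M homeoM1 homeoVM homeoMV.

(* Uniform convergence, with respect to the uniformity made of the            *)
(* neighbourhoods of the diagonal: this is the only uniformity compatible     *)
(* with the topology when T is compact Hausdorff, hence the one induced by    *)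
(* any compatible metric when T is moreover metrizable.                       *)
Definition diag_nbhs (U : set (T * T)) : Prop := forall x : T, nbhs (x, x) U.

Definition uniform_open (A : set homeo) : Prop :=
  forall f, A f -> exists2 U, diag_nbhs U &
    [set g : homeo | forall x, U (f x, g x)] `<=` A.

Lemma uniform_openT : uniform_open setT.
Proof. by move=> f _; exists setT => // x; exact: filterT. Qed.

Lemma uniform_openI : setI_closed uniform_open.
Proof.
move=> A B oA oB f [Af Bf].
have [U nU UA] := oA _ Af; have [V nV VB] := oB _ Bf.
exists (U `&` V); first by move=> x; exact: filterI.
by move=> g UVg; split; [apply: UA|apply: VB] => x; case: (UVg x).
Qed.

Lemma uniform_open_bigU (I : Type) (A : I -> set homeo) :
  (forall i, uniform_open (A i)) -> uniform_open (\bigcup_i A i).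
Proof.
move=> oA f [i _ /(oA i)[U nU UA]]; exists U => // g /UA Ag.
by exists i.
Qed.

HB.instance Definition _ := isOpenTopological.Build homeo
  uniform_openT uniform_openI uniform_open_bigU.

End Homeo.

(* Flows of a subgroup H, with the subspace topology, of an ambient group G.  *)
(* The values of the action outside of H are irrelevant.                      *)
Section Flows.
Local Open Scope group_scope.
Context (G : groupWithTopologyType) (H : set G).

Record flow := Flow {
  flow_space :> topologicalType;
  flow_nonempty : [set: flow_space] !=set0;
  flow_compact : compact [set: flow_space];
  flow_hausdorff : hausdorff_space flow_space;
  act : G -> flow_space -> flow_space;
  act1 : forall x, act 1 x = x;
  actM : forall g h x, H g -> H h -> act (g * h) x = act g (act h x);
  act_continuous :
    {within H `*` [set: flow_space], continuous (fun p => act p.1 p.2)} }.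

Definition minimal_flow (X : flow) : Prop :=
  forall x : X, dense [set act g x | g in H].

Definition flow_epimorphism (X Y : flow) (p : X -> Y) : Prop :=
  [/\ continuous p,
      forall g x, H g -> p (act g x) = act g (p x) &
      forall y, exists x, p x = y].

Definition universal_minimal_flow (M : flow) : Prop :=
  minimal_flow M /\
  forall X : flow, minimal_flow X -> exists p : M -> X, flow_epimorphism p.

(* The universal minimal flow is unique up to isomorphism: it is a point as   *)
(* soon as some universal minimal flow is.                                    *)
Definition extremely_amenable : Prop :=
  exists2 M : flow, universal_minimal_flow M & forall x y : M, x = y.

End Flows.

Section Quotient.
Context (L : language) (F : fraisse_category L) (X : inv_seq F).

Lemma nbhs_lim_proj (n : nat) (x : ilim X) :
  nbhs x [set y | lim_proj n y = lim_proj n x].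
Proof.
have /(_ x) c : continuous (fun y : ilim X =>
    (lim_proj n y : discrete_topology (level X n))).
  move=> y; apply: (@continuous_comp _ _ _ (@set_val _ (@threads L F X))
    (@proj nat (fun n => discrete_topology (level X n)) n)).
    exact: initial_continuous.
  exact: proj_continuous.
exact: (c _ (@discrete_set1 (discrete_topology (level X n)) (lim_proj n x))).
Qed.

Lemma ilim_mor_cont (h : ilim X -> ilim X) : ilim_mor h -> continuous h.
Proof.
move=> [i [hn [_ _ hE]]]; apply: continuous_comp_initial => x.
apply/cvg_sup => [|n U /= [_ [[V _ <-] Vx VU]]].
  exact/fmap_filter/nbhs_filter.
change (nbhs x (fun y => U (set_val (h y)))).
apply: filterS (nbhs_lim_proj (i n) x) => y /= xy.
apply: VU; change (V (lim_proj n (h y))); rewrite hE xy -hE; exact: Vx.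
Qed.

Lemma ilim_mor_adj (h : ilim X -> ilim X) : ilim_mor h ->
  forall x y, adj (ilim_str X) x y -> adj (ilim_str X) (h x) (h y).
Proof.
move=> [i [hn [_ mhn hE]]] x y /adj_ilimE xy; apply/adj_ilimE => n.
have [[hR _] _ _] := mor_surjective (mhn n).
rewrite !hE /adj; move: (hR None _ (xy (i n))).
by congr rel_interp; exact: val_inj.
Qed.

Context (trX : transitive_limit X).

Definition limit_rel (x y : ilim X) : bool := `[< adj (ilim_str X) x y >].

Lemma limit_rel_equiv : equiv_class_of limit_rel.
Proof.
split.
- by move=> x; apply/asboolP/adj_ilimE => n; exact: (obj_graph _).1.
- move=> x y; apply/asboolP/asboolP => /adj_ilimE xy; apply/adj_ilimE => n;
  exact: (obj_graph _).2.
- by move=> y x z /asboolP xy /asboolP yz; apply/asboolP; exact: trX yz.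
Qed.

Definition limit_equiv : equiv_rel (ilim X) := EquivRelPack limit_rel_equiv.

Definition limit_quotient : topologicalType :=
  quotient_topology {eq_quot limit_equiv}.

Definition limit_pi (x : ilim X) : limit_quotient :=
  \pi_{eq_quot limit_equiv} x.

Lemma limit_piP (x y : ilim X) :
  limit_pi x = limit_pi y <-> adj (ilim_str X) x y.
Proof.
split=> [/eqquotP/asboolP //|xy].
by apply/eqquotP/asboolP.
Qed.

Definition induced (f : ilim X -> ilim X) (y : limit_quotient) :
    limit_quotient :=
  limit_pi (f (repr (y : {eq_quot limit_equiv}))).

Lemma induced_pi (f : ilim X -> ilim X) : ilim_mor f ->
  forall x, induced f (limit_pi x) = limit_pi (f x).
Proof.
move=> mf x; apply/limit_piP/(ilim_mor_adj mf)/limit_piP.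
exact: reprK.
Qed.

Lemma limit_piK (y : limit_quotient) :
  limit_pi (repr (y : {eq_quot limit_equiv})) = y.
Proof. exact: reprK. Qed.

Lemma induced_cont (f : ilim X -> ilim X) : ilim_mor f ->
  continuous (induced f).
Proof.
move=> mf; apply/quotient_continuous.
rewrite (_ : _ \o _ = limit_pi \o f); last first.
  by apply/funext => x; exact: induced_pi.
move=> x; apply: continuous_comp; first exact: ilim_mor_cont.
exact: pi_continuous.
Qed.

Lemma inducedK (f g : ilim X -> ilim X) : ilim_mor f -> ilim_mor g ->
  cancel f g -> cancel (induced f) (induced g).
Proof.
move=> mf mg fgK y; rewrite -[y]limit_piK.
by rewrite !induced_pi // fgK.
Qed.

Definition Phi (f : aut X) : homeo limit_quotient :=
  Homeo (inducedK (aut_mor f) (aut_inv_mor f) (@aut_funK _ _ _ f))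
        (inducedK (aut_inv_mor f) (aut_mor f) (@aut_invK _ _ _ f))
        (induced_cont (aut_mor f)) (induced_cont (aut_inv_mor f)).

Lemma PhiE (f : aut X) (x : ilim X) : Phi f (limit_pi x) = limit_pi (f x).
Proof. exact: (induced_pi (aut_mor f)). Qed.

End Quotient.

(* Main.v *)
Require Import Defs.
From mathcomp Require Import all_boot all_order all_algebra.
From mathcomp Require Import all_classical all_reals.
From mathcomp Require Import topology normedtype Rstruct.
From mathcomp Require Import lra.

Set Implicit Arguments.
Unset Strict Implicit.
Unset Printing Implicit Defensive.

Local Open Scope classical_set_scope.

(** Write FF for the limit of X, T for its quotient by R, G for the group of
    automorphisms of FF and H for the closure of Phi[G]. Two facts tie the
    combinatorics of the category to the uniform structure of T.

    - Homogeneity ([homogeneity]): any two morphisms from FF to the same object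
      differ by an automorphism of FF. Hence, once a morphism alpha : FF -> A is
      fixed, a colouring of the morphisms FF -> A is a colouring of G, by
      g |-> alpha o g.
    - Adjacency is nearness: by compactness of FF, every neighbourhood of the
      diagonal of T contains all pairs (q x, q y) such that x and y have
      adjacent projections at some level n ([adj_in_diag_nbhs]); conversely
      finitely many continuous real functions on T detect adjacency after a
      morphism to a finite object ([separating_functions], by Urysohn's
      lemma). Thus the thickening by 1 of a set of epimorphisms plays the role
      of a small uniform thickening of a subset of Phi[G].

    Since a point is an H-flow, H is extremely amenable exactly when all minimal
    H-flows are points ([extremely_amenableP]).

    From the Ramsey property to amenability ([ramsey_fixed_point]). If no point
    of a flow K were fixed, K would be covered by finitely many open sets W_i
    with elements p_i of G such that p_i W_i is disjoint from W_i. The position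
    of g x0 in this cover is, up to a small neighbourhood of the unit of H, a
    colouring of the morphisms to a level A_n; the Ramsey property for all maps
    through which the projections of the p_i to A_n factor yields g and a single
    index i such that both g x0 and p_i g x0 lie in W_i, a contradiction. A
    fixed point in a minimal flow is the whole flow.

    From amenability to the Ramsey property. Zorn's lemma turns the triviality
    of minimal flows into a fixed point theorem
    ([extremely_amenable_fixed_point]). It is applied to the closure of the
    orbit of the vector of distances to the colour classes, in a space of
    Lipschitz functions on Homeo(T). A fixed point is constant on Phi[G]; since
    some distance vanishes at each element of Phi[G], some coordinate i of this
    constant is as small as desired, and a translate of the distance vector that
    approximates the fixed point at finitely many elements of Phi[G] exhibits a
    copy of Epi(B, A) inside the thickening of the colour i ([limit_ramsey]).
    This is a Ramsey theorem for colourings of the morphisms FF -> A; an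
    ultrafilter limit of bad colourings of the sets Epi(A_n, A) brings it down
    to the finite level ([limit_ramsey_descent]). *)

(** * Morphisms from the limit and its homogeneity *)

Section Sequences.
Context (L : language) (F : fraisse_category L).
Implicit Types X Y Z : inv_seq F.

Lemma mor_surj (B A : obj F) (f : B -> A) :
  mor f -> forall a, exists b, f b = a.
Proof. by case/mor_surjective. Qed.

Lemma mor_adj (B A : obj F) (f : B -> A) : mor f ->
  forall a b, adj (str B) a b -> adj (str A) (f a) (f b).
Proof.
case/mor_surjective => -[fR _] _ _ a b /fR; rewrite /adj.
by congr rel_interp; exact: val_inj.
Qed.

(** Dropping the first level makes the induction of [lim_proj_surj] go through
    without any transport along equalities between levels. *)
Definition tail_seq X : inv_seq F :=
  @InvSeq L F (fun n => level X n.+1) (fun n => @bond L F X n.+1)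
    (fun n => bond_mor X n.+1).

Definition thread X (x : forall n, level X n)
    (xP : forall n, bond (x n.+1) = x n) : ilim X :=
  exist (fun x => x \in @threads L F X) x (mem_set xP).

Lemma lim_proj_surj X n (a : level X n) : exists x : ilim X, lim_proj n x = a.
Proof.
elim: n X a => [|n IH] X a.
  pose up k c := projT1 (cid (mor_surj (bond_mor X k) c)).
  have upK k : cancel (@up k) (@bond _ _ X k).
    by move=> c; rewrite /up; case: cid.
  pose x := fix x k : level X k := if k is j.+1 then up j (x j) else a.
  have xP k : bond (x k.+1) = x k by exact: upK.
  by exists (thread xP).
have [y ya] := IH (tail_seq X) a.
pose x j : level X j := if j is k.+1 then @lim_proj L F (tail_seq X) k y
  else bond (@lim_proj L F (tail_seq X) 0 y).
have xP j : bond (x j.+1) = x j.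
  by case: j => //= j; exact: (@lim_projP L F (tail_seq X) y j).
by exists (thread xP).
Qed.

(** The maps h_m of a morphism to a constant sequence are all obtained from h_0
    by composition with the bonding maps. *)
Lemma ilim_mor_objP X (A : obj F) (phi : ilim X -> A) :
  ilim_mor_obj phi <->
  exists n (k : level X n -> A), mor k /\ forall x, phi x = k (lim_proj n x).
Proof.
split=> [[i [hn [_ mhn hE]]]|[n [k [mk phiE]]]].
  by exists (i 0), (hn 0); split=> // x; rewrite -hE.
have down m : {h : level X (m + n) -> A | mor h /\
    forall x, phi x = h (lim_proj (m + n) x)}.
  elim: m => [|m [h [mh hE]]]; first by exists k.
  exists (h \o @bond _ _ X (m + n)); split.
    exact: mor_comp mh (bond_mor X (m + n)).
  by move=> x /=; rewrite lim_projP.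
exists (fun m => m + n), (fun m => projT1 (down m)); split=> //.
- by move=> m; case: (projT2 (down m)).
- by move=> m x; have [_ <-] := projT2 (down m).
Qed.

(** Stating the factorization on the limit, where the projections are onto,
    avoids any arithmetic on iterated bonding maps. *)
Lemma lim_proj_factor X n m : n <= m -> exists2 k : level X m -> level X n,
  mor k & forall x, lim_proj n x = k (lim_proj m x).
Proof.
move=> /subnK <-; elim: (m - n) => [|p [k mk kE]].
  by exists id => //; exact: mor_id.
exists (k \o @bond _ _ X (p + n)); first exact: mor_comp mk (bond_mor X _).
by move=> x /=; rewrite lim_projP.
Qed.

Lemma factor_above X (A : obj F) (phi : ilim X -> A) : ilim_mor_obj phi ->
  exists n0, forall n, n0 <= n -> exists2 k : level X n -> A, mor k &
    forall x, phi x = k (lim_proj n x).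
Proof.
case/ilim_mor_objP => n0 [k [mk kE]]; exists n0 => n.
move=> /(lim_proj_factor X)[h mh hE].
by exists (k \o h) => [|x /=]; [exact: mor_comp|rewrite kE hE].
Qed.

Lemma lim_proj_mor X n : ilim_mor_obj (@lim_proj L F X n).
Proof. by apply/ilim_mor_objP; exists n, id; split=> //; exact: mor_id. Qed.

Lemma ilim_mor_obj_comp X (A B : obj F) (phi : ilim X -> B) (f : B -> A) :
  mor f -> ilim_mor_obj phi -> ilim_mor_obj (f \o phi).
Proof.
move=> mf /ilim_mor_objP[n [k [mk kE]]]; apply/ilim_mor_objP.
exists n, (f \o k); split; first exact: mor_comp.
by move=> x /=; rewrite kE.
Qed.

Lemma ilim_mor_obj_precomp X Y (A : obj F) (phi : ilim Y -> A)
    (g : ilim X -> ilim Y) :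
  ilim_mor_obj phi -> ilim_mor g -> ilim_mor_obj (phi \o g).
Proof.
move=> /ilim_mor_objP[n [k [mk kE]]] [i [hn [_ mhn gE]]].
apply/ilim_mor_objP; exists (i n), (k \o hn n); split; first exact: mor_comp.
by move=> x /=; rewrite kE gE.
Qed.

Lemma ilim_mor_id X : ilim_mor (@id (ilim X)).
Proof. by exists id, (fun=> id); split=> // n; exact: mor_id. Qed.

Lemma ilim_mor_comp X Y Z (g : ilim Y -> ilim Z) (h : ilim X -> ilim Y) :
  ilim_mor g -> ilim_mor h -> ilim_mor (g \o h).
Proof.
move=> [i [gn [ilt mgn gE]]] [j [hn [jlt mhn hE]]].
exists (j \o i), (fun n => gn n \o hn (i n)); split.
- move=> n /=.
  have {}jlt : {homo j : m p / m < p} by exact: (homo_ltn ltn_trans jlt).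
  exact/jlt/ilt.
- by move=> n; apply: (mor_comp (mgn n) (mhn (i n))).
- by move=> n x; exact: etrans (gE n (h x)) (congr1 (gn n) (hE (i n) x)).
Qed.

Definition aut_id X : aut X :=
  Aut (fun=> erefl) (fun=> erefl) (@ilim_mor_id X) (@ilim_mor_id X).

Definition aut_opp X (g : aut X) : aut X :=
  Aut (@aut_invK _ _ _ g) (@aut_funK _ _ _ g) (aut_inv_mor g) (aut_mor g).

Definition aut_comp X (g h : aut X) : aut X :=
  Aut (can_comp (@aut_funK _ _ _ g) (@aut_funK _ _ _ h))
      (can_comp (@aut_invK _ _ _ h) (@aut_invK _ _ _ g))
      (ilim_mor_comp (aut_mor g) (aut_mor h))
      (ilim_mor_comp (aut_inv_mor h) (aut_inv_mor g)).

End Sequences.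

Section Homogeneity.
Context (L : language) (F : fraisse_category L) (X : inv_seq F).

(** The back-and-forth argument produces maps t_j between levels e_j such that
    t_j o t_(j+1) is a bonding map. The maps of even index define an
    endomorphism g of the limit; applied to the shifted sequence, the same
    statement turns the maps of odd index into the inverse of g. *)
Lemma zigzag_map (e : nat -> nat)
    (t : forall j, level X (e j.+1) -> level X (e j)) :
  (forall j, mor (t j)) -> (forall j, e j < e j.+2) ->
  (forall j x, t j (t j.+1 (lim_proj (e j.+2) x)) = lim_proj (e j) x) ->
  exists2 g : ilim X -> ilim X, ilim_mor g &
    forall n x, lim_proj (e n.*2) (g x) = t n.*2 (lim_proj (e n.*2.+1) x).
Proof.
move=> mt elt tE.
have ege n : n <= e n.*2 by elim: n => // n IH; exact: leq_ltn_trans IH (elt _).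
have bex n : {b : level X (e n.*2) -> level X n | mor b /\
    forall x, lim_proj n x = b (lim_proj (e n.*2) x)}.
  by apply/cid; have [b mb bE] := lim_proj_factor X (ege n); exists b.
pose b n := projT1 (bex n).
have bE n x : lim_proj n x = b n (lim_proj (e n.*2) x).
  by case: (projT2 (bex n)).
(* A thread that is the image of x at an even level e (2n + 2) is the image
   of x at the previous even level, by going around two triangles. *)
have descend x z n :
    lim_proj (e n.*2.+2) z = t n.*2.+2 (lim_proj (e n.*2.+3) x) ->
    lim_proj (e n.*2) z = t n.*2 (lim_proj (e n.*2.+1) x).
  by move=> zx; rewrite -[LHS]tE zx tE.
pose y (x : ilim X) n : level X n := b n (t n.*2 (lim_proj (e n.*2.+1) x)).
have yP x n : bond (y x n.+1) = y x n.
  have [z zE] := lim_proj_surj (t n.*2.+2 (lim_proj (e n.*2.+3) x)).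
  rewrite /y -(descend _ _ _ zE) -bE -[RHS]lim_projP [in RHS]bE.
  exact: (congr1 (fun c : level X (e n.+1.*2) => bond (b n.+1 c)) (esym zE)).
pose g x : ilim X := thread (yP x).
have gy x n : lim_proj n (g x) = y x n by [].
exists g => [|n x].
  exists (fun n => e n.*2.+1), (fun n => b n \o t n.*2); split => //.
  by move=> n; apply: (mor_comp _ (mt _)); case: (projT2 (bex n)).
(* The thread g x is given at level m through the even level e (2m); at the
   level e (2n) this means passing through the much higher e (2 (e (2n))). *)
have down N z : n <= N ->
    lim_proj (e N.*2) z = t N.*2 (lim_proj (e N.*2.+1) x) ->
    lim_proj (e n.*2) z = t n.*2 (lim_proj (e n.*2.+1) x).
  move=> /subnK <-.
  by elim: (N - n) => [//|m IH] /descend /IH.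
have [z zE] := lim_proj_surj (t (e n.*2).*2 (lim_proj (e (e n.*2).*2.+1) x)).
by rewrite gy /y -zE -bE; exact: down (ege n) zE.
Qed.

Hypothesis limX : is_fraisse_limit X.

(** The extension property of the limit, read on its levels. *)
Lemma lift_above (A B : obj F) (f : ilim X -> A) (g : B -> A) m :
  ilim_mor_obj f -> mor g -> exists n (h : level X n -> B),
  [/\ m < n, mor h & forall x, g (h (lim_proj n x)) = f x].
Proof.
move=> mf mg; have [h mh ghf] := limX.2 _ _ _ _ mf mg.
have [n0 hn] := factor_above mh.
have [|k mk kE] := hn (maxn n0 m.+1); first exact: leq_maxl.
exists (maxn n0 m.+1), k; split=> //; first exact: leq_maxr.
by move=> x; rewrite -kE -ghf.
Qed.

(** The source and the target are fields, so that in the zigzag below the target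
    of each map is the source of the previous one by conversion. *)
Record level_map := LevelMap {
  lm_src : nat; lm_tgt : nat;
  lm_fun : level X lm_src -> level X lm_tgt;
  lm_mor : mor lm_fun }.

Lemma level_map_step (s : level_map) :
  {c & {k : level X c -> level X (lm_src s) | [/\ lm_tgt s < c, mor k &
    forall x, lm_fun (k (lim_proj c x)) = lim_proj (lm_tgt s) x]}}.
Proof.
have /cid[c /cid[k H]] :=
  lift_above (lm_tgt s) (@lim_proj_mor L F X _) (lm_mor s).
by exists c, k.
Qed.

(** Back and forth: a lift h of psi along a factor f of phi is a map between
    levels, and lifting the projections alternately along the maps already built
    extends it to a zigzag, whose even part is the required automorphism. *)
Lemma homogeneity (A : obj F) (phi psi : ilim X -> A) :
  ilim_mor_obj phi -> ilim_mor_obj psi ->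
  exists g : aut X, forall x, phi (g x) = psi x.
Proof.
move=> /ilim_mor_objP[m [f [mf phiE]]] mpsi.
have [n [h [_ mh hE]]] := lift_above 0 mpsi mf.
have kmor s : mor (projT1 (projT2 (level_map_step s))).
  by case: (projT2 (projT2 (level_map_step s))).
pose next s : level_map := LevelMap (kmor s).
pose S := fix S j := if j is i.+1 then next (S i) else LevelMap mh.
pose e j := lm_tgt (S j).
pose t j : level X (e j.+1) -> level X (e j) := @lm_fun (S j).
have mt j : mor (t j) := lm_mor (S j).
have elt j : e j < e j.+2.
  by case: (projT2 (projT2 (level_map_step (S j)))).
have tE j x : t j (t j.+1 (lim_proj (e j.+2) x)) = lim_proj (e j) x.
  by case: (projT2 (projT2 (level_map_step (S j)))) => _ _; exact.
have ege j : j <= e j.*2.+1.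
  by elim: j => // j IH; exact: leq_ltn_trans IH (elt _).
have ege' j : j <= e j.*2.
  by elim: j => // j IH; exact: leq_ltn_trans IH (elt _).
have [g mg gE] := zigzag_map mt elt tE.
have [g' mg' g'E] := @zigzag_map
  (fun j => e j.+1) (fun j => t j.+1)
  (fun j => mt j.+1) (fun j => elt j.+1) (fun j => tE j.+1).
have gK : cancel g g'.
  move=> x; apply: ilim_eq => j; have [b _ bE] := lim_proj_factor X (ege j).
  by rewrite !bE g'E (gE j.+1) tE.
have g'K : cancel g' g.
  move=> x; apply: ilim_eq => j.
  have [b _ bE] := lim_proj_factor X (ege' j).
  by rewrite !bE gE g'E tE.
exists (Aut gK g'K mg mg') => x /=.
by rewrite phiE (gE 0) -hE.
Qed.

End Homogeneity.

(** * Compactness of the limit and of its quotient *)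

Section Subtypes.
Context (T : topologicalType) (A : set T).

Lemma nbhs_set_val (p : set_type A) (W : set T) :
  nbhs (set_val p) W -> nbhs p (set_val @^-1` W).
Proof. exact: (@initial_continuous _ _ (@set_val T A) p). Qed.

Lemma nbhs_set_typeP (p : set_type A) (B : set (set_type A)) : nbhs p B ->
  exists2 W, nbhs (set_val p) W & set_val @^-1` W `<=` B.
Proof.
move=> [_ [[W oW <-] Wp] WB]; exists W => //.
exact: open_nbhs_nbhs.
Qed.

Lemma compact_set_type : compact A -> compact [set: set_type A].
Proof.
move=> cA F PF _.
have [|p [Ap Fp]] := cA (set_val @ F) (fmap_proper_filter _ PF).
  by apply: (@filterE _ F _ (set_val @^-1` A)) => x; exact: set_valP.
exists (exist _ p (mem_set Ap)); split=> // S B FS.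
move=> /nbhs_set_typeP[W /Fp + WB].
have FS' : (set_val @ F) (set_val @` S).
  apply: (@filterS _ F _ S (set_val @^-1` (set_val @` S)) _ FS) => x Sx.
  by exists x.
by move=> /(_ _ FS')[_ [[x Sx <-] Wx]]; exists x; split=> //; exact: WB.
Qed.

Lemma hausdorff_set_type : hausdorff_space T -> hausdorff_space (set_type A).
Proof.
move=> hT p q pq; apply: val_inj; apply: hT => U V /nbhs_set_val pU.
move=> /nbhs_set_val qV; have [x [Ux Vx]] := pq _ _ pU qV.
by exists (set_val x).
Qed.

End Subtypes.

Section Limit.
Context (L : language) (F : fraisse_category L) (X : inv_seq F).

Lemma ilim_compact : compact [set: ilim X].
Proof.
apply: compact_set_type.
pose level_set n := [set: discrete_topology (level X n)].
apply: subclosed_compact (tychonoff (A := level_set) _) _ => //.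
  move=> x xcl n.
  have pr m : nbhs x [set y : prod_topology
      (fun n => discrete_topology (level X n)) | y m = x m].
    have c := @proj_continuous nat (fun n => discrete_topology (level X n)) m x.
    exact: (c _ (@discrete_set1 (discrete_topology (level X m)) (x m))).
  have [y [/(_ n) yn [/= yxS yx]]] := xcl _ (filterI (pr n.+1) (pr n)).
  by rewrite -yx -yxS.
move=> n; apply: finite_compact; exact: finite_finset.
Qed.

Lemma adj_down n m (x y : ilim X) : n <= m ->
  adj (str (level X m)) (lim_proj m x) (lim_proj m y) ->
  adj (str (level X n)) (lim_proj n x) (lim_proj n y).
Proof.
by move=> /(lim_proj_factor X)[k /mor_adj mk kE] /mk; rewrite -!kE.
Qed.

(** All compactness arguments on the limit go through this one: adjacency at
    level n of x_n and y_n, for all n, passes to a cluster point of the pairs,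
    because adjacency at a level implies adjacency at the lower ones. *)
Lemma adj_cluster (x y : nat -> ilim X) :
  (forall n, adj (str (level X n)) (lim_proj n (x n)) (lim_proj n (y n))) ->
  exists x0 y0, adj (ilim_str X) x0 y0 /\
    forall U N, nbhs (x0, y0) U -> exists2 n, N <= n & U (x n, y n).
Proof.
move=> xy.
have := compact_setX ilim_compact ilim_compact.
move=> /(_ ((fun n => (x n, y n)) @ \oo) _)[|[x0 y0] [_ cl]].
  exact: filterE.
have near_n N U : nbhs (x0, y0) U -> exists2 n, N <= n & U (x n, y n).
  move=> nU; have oN : ((fun n => (x n, y n)) @ \oo)
      [set (x n, y n) | n in [set n | N <= n]].
    by exists N => // n Nn; exists n.
  by have [_ [[n Nn <-] Un]] := cl _ _ oN nU; exists n.
exists x0, y0; split=> [|U N]; last exact: near_n.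
apply/adj_ilimE => m.
have [|n mn [/= <- <-]] := near_n m
    [set p | lim_proj m p.1 = lim_proj m x0 /\ lim_proj m p.2 = lim_proj m y0].
  exists ([set z | lim_proj m z = lim_proj m x0],
          [set z | lim_proj m z = lim_proj m y0]) => //=.
  by split; exact: nbhs_lim_proj.
exact: adj_down mn (xy n).
Qed.

Context (trX : transitive_limit X).
Local Notation T := (limit_quotient trX).
Local Notation q := (limit_pi trX).

Lemma limit_pi_continuous : continuous q.
Proof. exact: pi_continuous. Qed.

(** Otherwise bad pairs, one for each n, would cluster at a pair of equivalent
    points, around which U holds. *)
Lemma adj_in_diag_nbhs (U : set (T * T)) : diag_nbhs U ->
  exists n, forall x y : ilim X,
    adj (str (level X n)) (lim_proj n x) (lim_proj n y) -> U (q x, q y).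
Proof.
move=> dU; apply: contrapT => /forallNP H.
have {}H n : {xy : ilim X * ilim X |
    adj (str (level X n)) (lim_proj n xy.1) (lim_proj n xy.2) /\
    ~ U (q xy.1, q xy.2)}.
  apply: cid; have /existsNP[x /existsNP[y /not_implyP xy]] := H n.
  by exists (x, y).
have [x0 [y0 [/limit_piP xy0 cl]]] :=
  adj_cluster (fun n => (projT2 (H n)).1).
have [[A B] /= [nA nB] ABU] : nbhs (q x0, q y0) U by rewrite -xy0; exact: dU.
have /(cl _ 0)[n _ Un] : nbhs (x0, y0)
    (fun p : ilim X * ilim X => U (q p.1, q p.2)).
  exists (q @^-1` A, q @^-1` B).
    by split; exact: limit_pi_continuous.
  by move=> p [/= Ap Bp]; exact: ABU.
by case: (projT2 (H n)) => _; apply.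
Qed.

Lemma quotient_compact : compact [set: T].
Proof.
rewrite (_ : setT = q @` setT); last first.
  by apply/seteqP; split=> // y _; exists (repr y) => //; exact: limit_piK.
apply: continuous_compact ilim_compact.
exact/continuous_subspaceT/limit_pi_continuous.
Qed.

(** The saturation of a closed set is closed because R is compact. *)
Lemma limit_pi_closed (C : set (ilim X)) : closed C -> closed (q @` C).
Proof.
move=> cC; rewrite -openC.
rewrite (_ : open _ = open (q @^-1` (~` (q @` C)))) //.
rewrite openE => x /= xC; rewrite /interior.
apply: contrapT => nx.
have H n : {zw : ilim X * ilim X | adj (ilim_str X) zw.1 zw.2 /\
    C zw.2 /\ lim_proj n zw.1 = lim_proj n x}.
  apply: cid; apply: contrapT => /forallNP zw; apply: nx.
  apply: filterS (nbhs_lim_proj n x) => z zx /= [w Cw wz].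
  by apply: (zw (z, w)); split; [exact/limit_piP|].
have [|x0 [y0 [xy0 cl]]] := @adj_cluster (fun n => (projT1 (H n)).1)
    (fun n => (projT1 (H n)).2).
  by move=> n; case: (projT2 (H n)) => /adj_ilimE.
have x0x : x0 = x.
  apply: ilim_eq => m.
  have [|n mn /= <-] := cl [set p | lim_proj m p.1 = lim_proj m x0] m.
    exists ([set z | lim_proj m z = lim_proj m x0], setT) => /=.
      by split; [exact: nbhs_lim_proj|exact: filterT].
    by move=> p [].
  have [k _ kE] := lim_proj_factor X mn.
  by rewrite !kE; case: (projT2 (H n)) => _ [_ ->].
apply: xC; exists y0; last by apply/esym/limit_piP; rewrite -x0x.
apply: cC => U nU.
have [|n _ /= Un] := cl [set p | U p.2] 0.
  by exists (setT, U) => [|p [] //]; split; [exact: filterT|].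
by exists (projT1 (H n)).2; split=> //; case: (projT2 (H n)) => _ [].
Qed.

(** The points whose class is contained in the star form an open saturated set
    because the quotient map is closed. *)
Lemma nbhs_star n (x : ilim X) : nbhs (q x) (q @` [set z |
  adj (str (level X n)) (lim_proj n x) (lim_proj n z)]).
Proof.
set W := [set z | _].
have cW : closed (~` W).
  rewrite closedC openE => z Wz; rewrite /interior.
  by apply: filterS (nbhs_lim_proj n z) => w /= wz; rewrite /W /= wz.
have := limit_pi_closed cW; rewrite -openC.
move=> oW; apply: (@filterS _ _ _ (~` (q @` (~` W)))); last first.
  apply: open_nbhs_nbhs; split=> //.
  by move=> [z Wz /esym/limit_piP/adj_ilimE/(_ n)].
move=> c nc; exists (repr c); last exact: limit_piK.
by apply: contrapT => Wc; apply: nc; exists (repr c) => //; exact: limit_piK.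
Qed.

(** If, for every n, the images of the stars of x and y at level n meet, then
    their common points cluster at the class of x and at the class of y. *)
Lemma quotient_hausdorff : hausdorff_space T.
Proof.
move=> a b ab; rewrite -(limit_piK a) -(limit_piK b).
have {ab} := ab; rewrite -{1}(limit_piK a) -{1}(limit_piK b).
set x := repr _; set y := repr _ => xy.
have H n : {zw : ilim X * ilim X | adj (ilim_str X) zw.1 zw.2 /\
    adj (str (level X n)) (lim_proj n x) (lim_proj n zw.1) /\
    adj (str (level X n)) (lim_proj n y) (lim_proj n zw.2)}.
  apply: cid; have [c [[z xz zc] [w yw wc]]] :=
    xy _ _ (nbhs_star n x) (nbhs_star n y).
  by exists (z, w); split=> //; apply/(limit_piP trX); rewrite zc wc.
have [|z [w [zw cl]]] := @adj_cluster (fun n => (projT1 (H n)).1)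
    (fun n => (projT1 (H n)).2).
  by move=> n; case: (projT2 (H n)) => /adj_ilimE.
have lev m : adj (str (level X m)) (lim_proj m x) (lim_proj m z) /\
    adj (str (level X m)) (lim_proj m y) (lim_proj m w).
  have [|n mn /= [<- <-]] := cl [set p | lim_proj m p.1 = lim_proj m z /\
     lim_proj m p.2 = lim_proj m w] m.
    exists ([set p | lim_proj m p = lim_proj m z],
            [set p | lim_proj m p = lim_proj m w]) => //=.
    by split; exact: nbhs_lim_proj.
  by case: (projT2 (H n)) => _ [xz yw]; split; apply: adj_down mn _.
have xz : q x = q z by apply/limit_piP/adj_ilimE => m; case: (lev m).
have yw : q y = q w by apply/limit_piP/adj_ilimE => m; case: (lev m).
by rewrite xz yw; apply/limit_piP.
Qed.

End Limit.

Lemma compact_seq_cover (K : topologicalType) (W : K -> set K) :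
  compact [set: K] -> (forall y, nbhs y (W y)) ->
  exists s : seq K, forall z, exists i : 'I_(size s), W (tnth (in_tuple s) i) z.
Proof.
move=> cK nW; apply: contrapT => /forallNP nos.
pose cov (s : seq K) : set K :=
  [set z | exists i : 'I_(size s), W (tnth (in_tuple s) i) z].
pose FF : set_system K := [set S | exists s, ~` cov s `<=` S].
have covE s z : cov s z <-> exists2 y, y \in s & W y z.
  split=> [[i Wi]|[y /(tnthP (in_tuple s))[i ->] Wy]]; last by exists i.
  by exists (tnth (in_tuple s) i) => //; exact: mem_tnth.
have PF : ProperFilter FF.
  split=> [[s sub]|].
    have /existsNP[z Hz] := nos s.
    exact: (sub z Hz).
  split=> [|P Q [s sP] [s' sQ]|P Q PQ [s sP]].
  - by exists [::].
  - exists (s ++ s') => z zss; split; [apply: sP|apply: sQ] => /covE[y ys Wy];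
      apply: zss; apply/covE; exists y; rewrite // mem_cat ys ?orbT //.
  - by exists s => z /sP/PQ.
have [y [_ cy]] := cK FF PF filterT.
have [|z [nz Wz]] := cy (~` cov [:: y]) (W y) _ (nW y); first by exists [:: y].
by apply: nz; exists ord0.
Qed.

(** * Distance at most one is adjacency *)

Section Distances.
Context (L : language) (F : fraisse_category L).

Lemma graph_dist_le1 (A : obj F) (a b : A) :
  (graph_dist a b <= 1)%E <-> adj (str A) a b.
Proof.
have rA := (obj_graph A).1.
rewrite /graph_dist; split.
  case: pselect => [w|//]; case: ex_minnP => l /asboolP[p [<- <- padj]] _.
  rewrite lee_fin => l1.
  have {l1} : l <= 1 by [].
  case: l padj => [|[|//]] padj _; first exact: rA.
  exact: padj.
move=> ab; case: pselect => [w|[]].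
  case: ex_minnP => l _ /(_ 1) l1; rewrite lee_fin.
  apply: l1; apply/asboolP.
  exists (fun i => if i is 0 then a else b); split=> // -[|//] _; exact: ab.
exists 1; apply/asboolP.
by exists (fun i => if i is 0 then a else b); split=> // -[|//] _; exact: ab.
Qed.

Lemma epi_dist_le1 (C A : obj F) (f g : epi C A) :
  (epi_dist f g <= 1)%E <-> forall c, adj (str A) (f c) (g c).
Proof.
rewrite /epi_dist; split.
  by move/Order.TotalTheory.bigmax_leP => [_ H] c; apply/graph_dist_le1/H.
move=> H; apply/Order.TotalTheory.bigmax_leP; split=> // c _.
exact/graph_dist_le1.
Qed.

End Distances.

(** * Flows, and the homomorphism Phi *)

Section FlowContinuity.
Local Open Scope group_scope.
Context (G : groupWithTopologyType) (H : set G) (K : flow H).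

Lemma act_near (h : G) (z : K) (W : set K) : H h -> nbhs (act h z) W ->
  exists V W', [/\ nbhs h V, nbhs z W' &
    forall g y, H g -> V g -> W' y -> W (act g y)].
Proof.
move=> Hh nW.
have /subspace_continuousP/(_ (h, z) (conj Hh I) W nW) := @act_continuous G H K.
rewrite nbhs_simpl/= => -[[V W'] /= [nV nW'] VW].
by exists V, W'; split=> // g y Hg Vg W'y; apply: (VW (g, y)).
Qed.

Lemma act_continuous_in (h : G) : H h -> continuous (act h : K -> K).
Proof.
move=> Hh z W /(act_near Hh)[V [W' [nV nW' VW]]].
apply: filterS nW' => y W'y; apply: VW => //.
exact: nbhs_singleton.
Qed.

End FlowContinuity.

Lemma closure_fixed (G : groupWithTopologyType) (D : set G)
    (K : flow (closure D)) (z : K) :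
  (forall g, D g -> act g z = z) -> forall g, closure D g -> act g z = z.
Proof.
move=> Dz g Dg; apply: (@flow_hausdorff _ _ K) => U V nU nV.
have [W [W' [nW nW' WW]]] := act_near Dg nU.
have [h [Dh Wh]] := Dg _ nW.
exists z; split; last exact: nbhs_singleton.
rewrite -(Dz h) //; apply: WW => //; first exact: subset_closure.
exact: nbhs_singleton.
Qed.

Lemma nbhs_homeo1 (T : topologicalType) (V : set (homeo T)) :
  nbhs (1%g : homeo T) V ->
  exists2 U, diag_nbhs U & forall g : homeo T, (forall x, U (x, g x)) -> V g.
Proof.
rewrite nbhsE => -[B [oB B1] BV].
by have [U dU UB] := oB _ B1; exists U => // g Ug; apply/BV/UB.
Qed.

Section PhiMorphism.
Local Open Scope group_scope.
Context (L : language) (F : fraisse_category L) (X : inv_seq F).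
Context (trX : transitive_limit X).

Lemma Phi_comp (g h : aut X) : Phi trX (aut_comp g h) = Phi trX g * Phi trX h.
Proof.
apply/homeo_eq/funext => y; rewrite -[y](limit_piK (trX := trX)).
by rewrite PhiE -[RHS]/(Phi trX g (Phi trX h _)) !PhiE.
Qed.

Lemma Phi_id : Phi trX (aut_id X) = 1.
Proof.
apply/homeo_eq/funext => y; rewrite -[y](limit_piK (trX := trX)).
by rewrite PhiE.
Qed.

Lemma Phi_opp (g : aut X) : Phi trX (aut_opp g) = (Phi trX g)^-1.
Proof. exact: homeo_eq. Qed.

End PhiMorphism.

(** * The Ramsey property gives fixed points *)

Section Forward.
Local Open Scope group_scope.
Context (L : language) (F : fraisse_category L) (X : inv_seq F).
Context (limX : is_fraisse_limit X) (trX : transitive_limit X).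
Local Notation H := (closure (range (@Phi L F X trX))).
Local Notation q := (limit_pi trX).

Lemma Phi_in_closure (g : aut X) : H (Phi trX g).
Proof. by apply: subset_closure; exists g. Qed.
Hint Resolve Phi_in_closure : core.

(** The finitely many maps [h] are those to which the Ramsey property is
    applied. *)
Lemma common_factor (I : finType) n0 (p : I -> aut X) : exists2 m, n0 <= m &
  forall i, exists2 h : level X m -> level X n0, mor h &
    forall x, lim_proj n0 (p i x) = h (lim_proj m x).
Proof.
have fac i : {n | forall m, n <= m -> exists2 h : level X m -> level X n0,
    mor h & forall x, lim_proj n0 (p i x) = h (lim_proj m x)}.
  apply: cid; apply: (@factor_above L F X _ (lim_proj n0 \o p i)).
  exact: ilim_mor_obj_precomp (@lim_proj_mor L F X n0) (aut_mor (p i)).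
exists (maxn n0 (\max_i projT1 (fac i))); first exact: leq_maxl.
move=> i; apply: (projT2 (fac i)).
exact: leq_trans (leq_bigmax i) (leq_maxr _ _).
Qed.

(** A flow without fixed point is covered by finitely many open sets, each moved
    off itself by some p in G. An epimorphism k from C to A_n is realized, along
    a morphism psi : FF -> C, by some g_k in G with pi_n o g_k = k o psi, and its
    colour is the index of a set of the cover that contains g_k x0. *)
Lemma ramsey_fixed_point (K : flow H) : approximate_ramsey F ->
  exists z : K, forall h, H h -> act h z = z.
Proof.
move=> arp; suff: exists z : K, forall g, act (Phi trX g) z = z.
  by move=> [z zP]; exists z; apply: closure_fixed => _ [g _ <-]; exact: zP.
apply: contrapT => /forallNP nofix.
(* For each y, a tuple (p, W, U, W') with W open around y and moved off itself
   by p, and W' so small that it stays in W under the g in H that are U-close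
   to the identity. *)
have D (y : K) : {t : aut X * set K *
      set (limit_quotient trX * limit_quotient trX) * set K |
    [/\ forall z, t.1.1.2 z -> ~ t.1.1.2 (act (Phi trX t.1.1.1) z),
        diag_nbhs t.1.2, nbhs y t.2 &
        forall g, H g -> (forall x, t.1.2 (x, g x)) ->
          forall z, t.2 z -> t.1.1.2 (act g z)]}.
  apply: cid; have /existsNP[p /eqP py] := nofix y.
  have := @flow_hausdorff _ _ K; rewrite open_hausdorff => /(_ _ _ py).
  move=> [[A B] /= [/set_mem pA /set_mem yB] [oA oB /eqP AB]].
  pose W := B `&` act (Phi trX p) @^-1` A.
  have nA : nbhs (act (Phi trX p) y) A by exact: open_nbhs_nbhs.
  have nW : nbhs (act 1 y) W.
    rewrite act1; apply: filterI; first exact: open_nbhs_nbhs.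
    exact: (@act_continuous_in _ _ K _ (@Phi_in_closure p) y A nA).
  have H1 : H 1 by rewrite -(Phi_id trX).
  have [V [W' [/nbhs_homeo1[U dU UV] nW' VW]]] := act_near H1 nW.
  exists (p, W, U, W'); split=> //=.
    move=> z [_ /= Az] [Bz _]; have : (A `&` B) (act (Phi trX p) z) by [].
    by rewrite AB.
  by move=> g Hg Ug z W'z; apply: VW => //; exact: UV.
have nD y : nbhs y (projT1 (D y)).2 by case: (projT2 (D y)).
have [s cov] := compact_seq_cover (@flow_compact _ _ K) nD.
pose Di (i : 'I_(size s)) := D (tnth (in_tuple s) i).
pose p i := (projT1 (Di i)).1.1.1.
have [|n nU] := @adj_in_diag_nbhs L F X trX
    [set xy | forall i, (projT1 (Di i)).1.2 xy].
  move=> x.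
  apply: (@filter_forall _ _ (fun i => (projT1 (Di i)).1.2) (nbhs (x, x))) => i.
  by case: (projT2 (Di i)) => _ dU _ _; exact: dU.
(* None stands for the identity, so that W contains g x0 as well as p g x0. *)
pose pp (o : option 'I_(size s)) : aut X := oapp p (aut_id X) o.
have [m nm hm] := common_factor n pp.
have [C HC] := arp (level X n) (level X m) (size s).
have [psi mpsi] := limX.1 C.
have gk (k : epi C (level X n)) :
    {g : aut X | forall x, lim_proj n (g x) = k (psi x)}.
  apply: cid; apply: (homogeneity limX (@lim_proj_mor L F X n)).
  exact: ilim_mor_obj_comp (epi_mor k) mpsi.
have [x0 _] := @flow_nonempty _ _ K.
pose col k := projT1 (cid (cov (act (Phi trX (projT1 (gk k))) x0))).
have colP k : (projT1 (Di (col k))).2 (act (Phi trX (projT1 (gk k))) x0).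
  by rewrite /col; case: cid.
have [f [i0 fi0]] := HC col.
have [g gE] : exists g : aut X, forall x, lim_proj m (g x) = f (psi x).
  apply: (homogeneity limX (@lim_proj_mor L F X m)).
  exact: ilim_mor_obj_comp (epi_mor f) mpsi.
(* With k of colour i0 at distance at most 1 from h o f, the automorphism
   pp o g takes x0 close to where the automorphism realizing k takes it. *)
have main o : (projT1 (Di i0)).1.1.2 (act (Phi trX (aut_comp (pp o) g)) x0).
  have [h mh hE] := hm o.
  have [|k ki0 /epi_dist_le1 kh] := fi0 (epi_comp (Epi mh) f).
    by exists (Epi mh).
  pose gi := aut_opp (projT1 (gk k)).
  rewrite (_ : Phi trX _ = Phi trX (aut_comp (aut_comp (pp o) g) gi) *
                          Phi trX (projT1 (gk k))); last first.
    by rewrite !Phi_comp Phi_opp -!mulgA mulVg mulg1.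
  rewrite actM //; have [_ _ _ UW] := projT2 (Di i0).
  apply: UW => //; last by rewrite -ki0; exact: colP.
  move=> y; rewrite -[y](limit_piK (trX := trX)); set x := repr y.
  rewrite -[x](@aut_invK _ _ _ (projT1 (gk k))); set x' := aut_inv _ x.
  rewrite PhiE /= aut_funK; apply: nU.
  by rewrite (projT2 (gk k)) hE gE; exact: kh.
have [Wp _ _ _] := projT2 (Di i0).
apply: (Wp _ (main None)).
have := main (Some i0); rewrite /= Phi_comp actM // !Phi_comp Phi_id mul1g.
exact.
Qed.

End Forward.

(** * Extreme amenability and minimal flows *)

Section OnePoint.
Local Open Scope group_scope.
Context (G : groupWithTopologyType) (H : set G).

Lemma minimal_fixed_point (K : flow H) (z : K) : minimal_flow K ->
  (forall h, H h -> act h z = z) -> forall x, x = z.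
Proof.
move=> mK zP x; apply: (@flow_hausdorff _ _ K) => U V nU nV.
have [|w [Uw [h Hh hzw]]] := mK z U^° _ (open_interior _).
  by exists x.
exists z; split; last exact: nbhs_singleton.
by rewrite -(zP h Hh) hzw; exact: interior_subset.
Qed.

Definition point_flow : flow H.
Proof.
refine (@Flow G H (discrete_topology unit) _ _ _ (fun _ => id) _ _ _).
- by exists tt.
- by apply: finite_compact; exact: (@finite_finset unit).
- by move=> [] [].
- by [].
- by [].
- apply: continuous_subspaceT => x.
  exact: (@cvg_snd G (discrete_topology unit)).
Defined.

Lemma extremely_amenableP : H 1 -> extremely_amenable H <->
  forall K : flow H, minimal_flow K -> forall x y : K, x = y.
Proof.
move=> H1; split=> [[M [_ univ] M1] K /univ[p [_ _ psurj]] x y|triv].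
  by have [[a <-] [b <-]] := (psurj x, psurj y); rewrite (M1 a b).
exists point_flow; last by move=> [] [].
split=> [[] O [[] Ott] _|K mK]; first by exists tt; split=> //; exists 1.
have [k _] := @flow_nonempty _ _ K.
exists (fun=> k); split=> [x|g x _|y]; first exact: cvg_cst.
  exact: triv.
by exists tt; exact: triv.
Qed.

End OnePoint.

(** * A fixed point theorem for extremely amenable groups *)

(** In the application below, Z is a product space and the action is jointly
    continuous only along an equicontinuous set containing Y. The minimal flow is
    found inside Y. *)
Section MinimalSubflow.
Local Open Scope group_scope.
Context (G : groupWithTopologyType) (D : set G).
Hypothesis D1 : D 1.
Hypothesis DM : forall g h, D g -> D h -> D (g * h).
Local Notation H := (closure D).

Context (Z : topologicalType) (hZ : hausdorff_space Z).
Context (a : G -> Z -> Z) (Y : set Z).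
Hypothesis a1 : forall z, a 1 z = z.
Hypothesis aM : forall g h z, a (g * h) z = a g (a h z).
Hypothesis Y0 : Y !=set0.
Hypothesis cY : compact Y.
Hypothesis YD : forall g z, D g -> Y z -> Y (a g z).
Hypothesis a_near : forall h z W, H h -> Y z -> nbhs (a h z) W ->
  exists V W', [/\ nbhs h V, nbhs z W' &
    forall g y, H g -> Y y -> V g -> W' y -> W (a g y)].

Let orb x := [set a g x | g in D].

(** Zorn's lemma is applied to the open complements of the closed sets; the
    minimal set is taken among the D-invariant ones, and the density of D-orbits
    then gives that of the larger H-orbits. *)
Lemma minimal_invariant_set : exists M : set Z,
  [/\ M `<=` Y, M !=set0, closed M, forall g z, D g -> M z -> M (a g z) &
      forall x, M x -> M `<=` closure (orb x)].
Proof.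
pose P : set (set Z) := [set A | [/\ open A, exists2 z, Y z & ~ A z &
  forall g z, D g -> Y z -> ~ A z -> ~ A (a g z)]].
have [F FP Ftot|A [[oA [x0 Yx0 Ax0] invA] maxA]] := @Zorn_bigcup Z P.
  split.
  - by apply: bigcup_open => A /FP[].
  - have [[A0 FA0]|F0] := pselect (F !=set0); last first.
      have [z Yz] := Y0; exists z => // -[A FA _].
      by apply: F0; exists A.
    pose FF : set_system Z := [set S | exists2 A, F A & Y `\` A `<=` S].
    have PF : ProperFilter FF.
      split=> [[A /FP[_ [z Yz Az] _] sub]|]; first exact: (sub z).
      split=> [|S S' [A FA AS] [A' FA' AS']|S S' SS' [A FA AS]].
      + by exists A0.
      + have [AA'|AA'] := Ftot _ _ FA FA'.
          by exists A' => // z [Yz Az]; split; [apply: AS|apply: AS'];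
            split=> // /AA'.
        by exists A => // z [Yz Az]; split; [apply: AS|apply: AS'];
          split=> // /AA'.
      + by exists A => // z /AS/SS'.
    have FY : FF Y by exists A0 => // z [].
    have [p [Yp clp]] := cY PF FY.
    exists p => // -[A FA Ap].
    have [oA _ _] := FP _ FA.
    have [|z [[_ Az] /Az//]] := clp (Y `\` A) A _ (open_nbhs_nbhs (conj oA Ap)).
    by exists A.
  - move=> g z Dg Yz nz [A FA Aa]; have [_ _ invA] := FP _ FA.
    apply: (invA g z) => // Az; apply: nz; by exists A.
have cYA : closed (Y `\` A).
  apply: closedI; first exact: compact_closed.
  exact: open_closedC.
exists (Y `\` A); split=> //.
- by exists x0; split.
- by move=> g z Dg [Yz Az]; split; [exact: YD|exact: invA].
move=> x [Yx Ax].
have orbx : orb x `<=` Y `\` A.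
  by move=> _ [g Dg <-]; split; [exact: YD|exact: invA].
have clx : closure (orb x) `<=` Y `\` A.
  by move=> z /(closureS orbx)/cYA.
move=> z [Yz Az]; apply: contrapT => nz.
apply: (maxA (~` closure (orb x))).
  split; first by move=> w Aw /clx[].
  by move=> /(_ z nz).
split.
- exact/closed_openC/closed_closure.
- exists x => // nx; apply: nx; apply: subset_closure.
  by exists 1 => //; exact: a1.
- move=> g w Dg Yw /contrapT wx nw; apply: nw => W nW.
  have [V [W' [nV nW' VW]]] := a_near (subset_closure Dg) Yw nW.
  have [_ [[h Dh <-] W'h]] := wx _ nW'.
  exists (a g (a h x)); split; first by exists (g * h); [exact: DM|exact: aM].
  apply: VW => //; [exact: subset_closure|exact: YD|exact: nbhs_singleton].
Qed.

(** The flow on a minimal set M is a single point, fixed by D. *)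
Lemma extremely_amenable_fixed_point : extremely_amenable H ->
  exists2 z, Y z & forall g, D g -> a g z = z.
Proof.
have [M [MY [m0 Mm0] cM MD Mmin]] := minimal_invariant_set.
have H1 : H 1 by exact: subset_closure.
have MH h z : H h -> M z -> M (a h z).
  move=> Hh Mz; apply: cM => W nW.
  have [V [W' [nV nW' VW]]] := a_near Hh (MY _ Mz) nW.
  have [g [Dg Vg]] := Hh _ nV.
  exists (a g z); split; first exact: MD.
  by apply: VW => //; [exact: subset_closure|exact: MY|exact: nbhs_singleton].
(* The default value m is taken only for g outside of H. *)
pose b (g : G) (m : set_type M) : set_type M := insubd m (a g (set_val m)).
have bE g (m : set_type M) : M (a g (set_val m)) ->
    set_val (b g m) = a g (set_val m).
  by move=> Mg; rewrite set_valE val_insubd mem_set.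
have bH g (m : set_type M) : H g -> set_val (b g m) = a g (set_val m).
  by move=> Hg; apply/bE/MH => //; exact: set_valP.
have val_inj' : injective (@set_val Z M) by rewrite set_valE; exact: val_inj.
have b1 m : b 1 m = m by apply: val_inj'; rewrite bH // a1.
have bM g h m : H g -> H h -> b (g * h) m = b g (b h m).
  move=> Hg Hh; apply: val_inj'; rewrite [RHS]bH // [in RHS]bH // -aM.
  by apply: bE; rewrite aM; apply: (MH _ _ Hg (MH _ _ Hh _)); exact: set_valP.
have bC : {within H `*` [set: set_type M], continuous (fun p => b p.1 p.2)}.
  apply/subspace_continuousP => -[h m] /= [Hh _] S /nbhs_set_typeP[W nW WS].
  rewrite bH // in nW.
  have [V [W' [nV nW' VW]]] := a_near Hh (MY _ (set_valP m)) nW.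
  exists (V, set_val @^-1` W') => /=.
    by split=> //; exact: nbhs_set_val.
  move=> [g y] /= [Vg W'y] [/= Hg _]; apply: WS; rewrite /preimage /= bH //.
  by apply: VW => //; exact/MY/set_valP.
pose m1 : set_type M := exist (fun x => x \in M) m0 (mem_set Mm0).
pose K : flow H := @Flow G H (set_type M)
  (ex_intro _ m1 I)
  (compact_set_type (subclosed_compact cM cY MY))
  (hausdorff_set_type hZ) b b1 bM bC.
have mK : minimal_flow K.
  move=> x O [o Oo] oO.
  have /nbhs_set_typeP[W nW WO] : nbhs (o : set_type M) O.
    exact: open_nbhs_nbhs.
  have [_ [[g Dg <-] Wg]] := Mmin _ (set_valP x) _ (set_valP o) _ nW.
  exists (b g x); split; last by exists g => //; exact: subset_closure.
  by apply: WO; rewrite /preimage /= bH //; exact: subset_closure.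
move=> /(extremely_amenableP H1)/(_ K mK) K1.
exists m0 => [|g Dg]; first exact: (MY _ Mm0).
have := bH g m1 (subset_closure Dg).
by rewrite (K1 (b g _) m1) /= => <-.
Qed.

End MinimalSubflow.

Import Order.TTheory GRing.Theory Num.Theory numFieldNormedType.Exports.

(** * Real functions on the quotient *)

Section RealProduct.
Local Open Scope ring_scope.
Context (R : realType) (I : choiceType).
Local Notation Z := (prod_topology (fun _ : I => R)).

Lemma prod_cvg (FF : set_system Z) (z : Z) : Filter FF ->
  (forall i e, 0 < e -> FF [set w | `|z i - w i| < e]) -> FF --> z.
Proof.
move=> fF zF; apply/cvg_sup => i U /= [_ [[V oV <-] Vz VU]].
have /nbhs_ballP[e /= e0 eV] : nbhs (z i) V by exact: open_nbhs_nbhs.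
apply: filterS (zF i e e0) => w zw; apply: VU; exact: eV.
Qed.

Lemma nbhs_coord (z : Z) i e : 0 < e -> nbhs z [set w : Z | `|z i - w i| < e].
Proof.
move=> e0; have c := @proj_continuous I (fun _ => R) i z.
exact: (c _ (nbhsx_ballx (z i) e e0)).
Qed.

End RealProduct.

Section Separation.
Local Open Scope ring_scope.
Context (R : realType) (L : language) (F : fraisse_category L) (X : inv_seq F).
Context (trX : transitive_limit X).
Local Notation T := (limit_quotient trX).
Local Notation q := (limit_pi trX).

Lemma closed_mor_preimage (A : obj F) (alpha : ilim X -> A) (S : set A) :
  ilim_mor_obj alpha -> closed (alpha @^-1` S).
Proof.
move=> /ilim_mor_objP[n [k [_ kE]]] x xS.
have [y [Sy /= yx]] := xS _ (nbhs_lim_proj n x).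
by rewrite /preimage /= kE -yx -kE.
Qed.

(** If a and b are not adjacent, the images in T of the fibres of a and b are
    disjoint, as equivalent points have adjacent images. So the fibre of a can
    be separated by a continuous function u a from all the fibres of the points
    that are not adjacent to a. *)
Lemma separating_functions (A : obj F) (alpha : ilim X -> A) :
  ilim_mor_obj alpha -> exists u : A -> T -> R,
    (forall a, continuous (u a)) /\
    forall x y, (forall a, `|u a (q x) - u a (q y)| < 1) ->
      adj (str A) (alpha x) (alpha y).
Proof.
move=> malpha.
pose C a := q @` (alpha @^-1` [set a]).
pose D a := q @` (alpha @^-1` [set b | ~ adj (str A) a b]).
have sepCD a : uniform_separator (C a) (D a).
  have nT := compact_normal
    (@quotient_hausdorff L F X trX) (@quotient_compact L F X trX).
  apply: (normal_separatorP (R := R)).1 => //.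
  - by apply: limit_pi_closed; exact: closed_mor_preimage malpha.
  - by apply: limit_pi_closed; exact: closed_mor_preimage malpha.
  rewrite -subset0 => _ [[x /= <- <-] [y /= nadj /limit_piP yx]].
  apply: nadj; have /ilim_mor_objP[n [k [mk kE]]] := malpha.
  rewrite !kE; apply: (mor_adj mk); apply: (obj_graph _).2.
  by move/adj_ilimE: yx; exact.
exists (fun a => Urysohn (C a) (D a)); split=> [a|x y xy].
  exact: Urysohn_continuous.
apply: contrapT => nadj; have := xy (alpha x).
have -> : Urysohn (C (alpha x)) (D (alpha x)) (q x) = 0 :> R.
  apply: (Urysohn_sub0 (sepCD (alpha x))).
  by exists (q x) => //; exists x.
have -> : Urysohn (C (alpha x)) (D (alpha x)) (q y) = 1 :> R.
  apply: (Urysohn_sub1 (sepCD (alpha x))).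
  by exists (q y) => //; exists y.
by rewrite sub0r normrN normr1 ltxx.
Qed.

End Separation.

(** * The flow of Lipschitz functions on the homeomorphism group *)

(** The functions u define a right invariant pseudometric on homeo T, namely
    the supremum over a and x of the distances between u a (h x) and u a (k x).
    It is only used through its closed balls [unif_close], which also make sense
    when the space or the index set is empty. *)
Section LipschitzFlow.
Local Open Scope ring_scope.
Context (R : realType) (T : topologicalType) (A : finType) (u : A -> T -> R).
Hypothesis cu : forall a, continuous (u a).

Definition unif_close (h k : homeo T) (e : R) : Prop :=
  forall a x, `|u a (h x) - u a (k x)| <= e.

Lemma unif_close_refl h : unif_close h h 0.
Proof. by move=> a x; rewrite subrr normr0. Qed.

Lemma unif_close_trans h k l e e' :
  unif_close h k e -> unif_close k l e' -> unif_close h l (e + e').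
Proof.
move=> hk kl a x; rewrite -(subrKA (u a (k x))).
by apply: le_trans (ler_normD _ _) _; exact: lerD.
Qed.

Lemma unif_close_sym h k e : unif_close h k e -> unif_close k h e.
Proof. by move=> hk a x; rewrite distrC. Qed.

Lemma unif_close_mulr h k g e :
  unif_close h k e -> unif_close (h * g)%g (k * g)%g e.
Proof. by move=> hk a x; exact: (hk a (g x)). Qed.

(** Right multiplication preserves the pseudometric, but left multiplication by
    k is only continuous: this is where continuity of the functions u a o k
    enters. *)
Lemma nbhs_unif_close (k h : homeo T) (e : R) : 0 < e ->
  nbhs h [set g : homeo T | unif_close (k * h)%g (k * g)%g e].
Proof.
move=> e0; rewrite nbhsE.
exists [set g : homeo T | exists2 e', e' < e &
    unif_close (k * h)%g (k * g)%g e'].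
  split; last by exists 0 => //; exact: unif_close_refl.
  move=> g [e' e'e hg].
  have d0 : 0 < (e - e') / 4 by lra.
  (* g is at distance at most e'; half of the gap e - e' is left to its
     neighbours, which thus stay at distance less than e. *)
  exists [set xy : T * T |
    forall a, `|u a (k xy.1) - u a (k xy.2)| < (e - e') / 2].
    move=> x; apply: (@filter_forall _ A
      (fun a (xy : T * T) => `|u a (k xy.1) - u a (k xy.2)| < (e - e') / 2)
      (nbhs (x, x))) => a.
    have nx : nbhs x [set y | `|u a (k x) - u a (k y)| < (e - e') / 4].
      have c : {for x, continuous (u a \o k)}.
        by apply: continuous_comp; [exact: homeo_cont|exact: cu].
      exact: (c _ (nbhsx_ballx (u a (k x)) _ d0)).
    exists ([set y | `|u a (k x) - u a (k y)| < (e - e') / 4],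
            [set y | `|u a (k x) - u a (k y)| < (e - e') / 4]) => //=.
    move=> [y z] [/= xy xz].
    rewrite -(subrKA (u a (k x))); apply: le_lt_trans (ler_normD _ _) _.
    rewrite distrC in xy; lra.
  move=> g' gg'; exists (e' + (e - e') / 2); first lra.
  apply: unif_close_trans hg _ => a x; exact: ltW (gg' x a).
by move=> g [e' e'e hg] a x; apply: le_trans (hg a x) (ltW e'e).
Qed.

Context (d : nat).
Local Notation I := (homeo T * 'I_d)%type.
Local Notation Z := (prod_topology (fun _ : I => R)).

(** The coordinate in 'I_d is the colour; translation acts on the group
    coordinate only. *)
Definition translate (g : homeo T) (z : Z) : Z :=
  fun hi => z ((hi.1 * g)%g, hi.2).

Lemma translate1 z : translate 1%g z = z.
Proof. by apply/funext => -[h i]; rewrite /translate /= mulg1. Qed.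

Lemma translateM g h z : translate (g * h)%g z = translate g (translate h z).
Proof. by apply/funext => -[k i]; rewrite /translate /= mulgA. Qed.

Definition lipschitz : set Z := [set z | (forall hi, z hi \in `[0, 1]) /\
  forall h k i e, 0 <= e -> unif_close h k e -> `|z (h, i) - z (k, i)| <= e].

Lemma lipschitz_compact : compact lipschitz.
Proof.
apply: subclosed_compact
  (tychonoff (A := fun _ : I => [set` `[0, 1 : R]]) _) _ => //.
- move=> z zl; split=> [hi|h k i e e0 hk].
    have c01 : closed [set` `[0, 1 : R]] by exact: interval_closed.
    apply: c01 => V nV.
    have c := @proj_continuous I (fun _ => R) hi z.
    have [y [[y01 _] Vy]] := zl _ (c _ nV); exists (y hi).
    by split; [exact: y01|exact: Vy].
  apply/ler_addgt0Pl => r r0; have r2 : 0 < r / 2 by lra.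
  have [y [[_ ylip] [/= zh zk]]] :=
    zl _ (filterI (nbhs_coord z (h, i) r2) (nbhs_coord z (k, i) r2)).
  have yhk := ylip _ _ i _ e0 hk.
  have := ler_normD (z (h, i) - y (h, i)) (y (h, i) - z (k, i)).
  have := ler_normD (y (h, i) - y (k, i)) (y (k, i) - z (k, i)).
  rewrite !subrKA (distrC (y (k, i))); lra.
- by move=> _; exact: segment_compact.
- by move=> z [].
Qed.

Lemma lipschitz_translate g z : lipschitz z -> lipschitz (translate g z).
Proof.
move=> [z01 zl]; split=> [hi|h k i e e0 hk]; first exact: z01.
by apply: zl => //; exact: unif_close_mulr.
Qed.

(** The action is jointly continuous on Lipschitz functions because these are
    equicontinuous: y (k g) - z (k h) is the sum of y (k g) - y (k h), small for
    g close to h uniformly in y, and of y (k h) - z (k h). *)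
Lemma translate_near h z W : nbhs (translate h z) W -> exists V W',
  [/\ nbhs h V, nbhs z W' &
    forall g y, lipschitz y -> V g -> W' y -> W (translate g y)].
Proof.
pose FF : set_system Z := [set S | exists V W', [/\ nbhs h V, nbhs z W' &
    forall g y, lipschitz y -> V g -> W' y -> S (translate g y)]].
have fF : Filter FF.
  split=> [|P Q [V [W1 [nV nW PW]]] [V' [W1' [nV' nW' QW]]]
           |P Q PQ [V [W1 [nV nW PW]]]].
  - by exists setT, setT; split=> //; exact: filterT.
  - exists (V `&` V'), (W1 `&` W1'); split; [exact: filterI|exact: filterI|].
    by move=> g y yl [Vg V'g] [Wy W'y]; split; [exact: PW|exact: QW].
  - by exists V, W1; split=> // g y yl Vg Wy; apply/PQ/PW.
suff : FF --> translate h z by exact.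
apply: prod_cvg => -[k i] e e0; have e2 : 0 < e / 2 by lra.
exists [set g | unif_close (k * h)%g (k * g)%g (e / 2)],
  [set w : Z | `|z ((k * h)%g, i) - w ((k * h)%g, i)| < e / 2]; split.
- exact: nbhs_unif_close.
- exact: nbhs_coord.
move=> g y [_ yl] /= hg zy; rewrite /translate /=.
rewrite -(subrKA (y ((k * h)%g, i))); apply: le_lt_trans (ler_normD _ _) _.
have := yl _ _ i _ (ltW e2) hg; lra.
Qed.

(** The fixed point is sought in the closure of the orbit of f, in order to be
    approximated by translates of f. *)
Lemma lipschitz_fixed_point (D : set (homeo T)) (f : Z) : D 1%g ->
  (forall g h, D g -> D h -> D (g * h)%g) -> lipschitz f ->
  extremely_amenable (closure D) ->
  exists2 z, closure [set translate g f | g in D] z &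
    forall g, D g -> translate g z = z.
Proof.
move=> D1 DM fl; set Y := closure [set translate _ _ | _ in _].
have cL : closed lipschitz.
  apply: compact_closed lipschitz_compact.
  by apply: hausdorff_product => _; exact: Rhausdorff.
have YL : Y `<=` lipschitz.
  move=> z Yz; apply: cL; apply: closureS Yz => _ [g Dg <-].
  exact: lipschitz_translate.
apply: (@extremely_amenable_fixed_point _ D D1 DM Z _ translate Y) => //.
- by apply: hausdorff_product => _; exact: Rhausdorff.
- exact: translate1.
- exact: translateM.
- by exists f; apply: subset_closure; exists 1%g => //; exact: translate1.
- exact: subclosed_compact (@closed_closure _ _) lipschitz_compact YL.
- move=> g z Dg Yz W nW; have [V [W' [nV nW' VW]]] := translate_near nW.
  have [_ [[h Dh <-] W'h]] := Yz _ nW'.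
  exists (translate g (translate h f)); split.
    by exists (g * h)%g; [exact: DM|exact: translateM].
  by apply: VW => //; [exact: lipschitz_translate|exact: nbhs_singleton].
- move=> h z W _ Yz nW; have [V [W' [nV nW' VW]]] := translate_near nW.
  by exists V, W'; split=> // g y _ /YL yl; exact: VW.
Qed.

Section DistanceTo.
Context (S : 'I_d -> set (homeo T)).

(** The infimum of this set is the distance from h to S i, truncated at 1; the
    truncation gives a value when S i is empty. *)
Definition near_dists (h : homeo T) (i : 'I_d) : set R :=
  [set e | 0 <= e /\ (e < 1 -> exists2 s, S i s & unif_close s h e)].

Definition dist_to : Z := fun hi => inf (near_dists hi.1 hi.2).

Let near_dists1 h i : near_dists h i 1.
Proof. by split => //; rewrite ltxx. Qed.

Let near_dists_lb h i : has_lbound (near_dists h i).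
Proof. by exists 0 => e []. Qed.

Let near_dists_n0 h i : near_dists h i !=set0.
Proof. by exists 1; exact: near_dists1. Qed.

Let dist_to_ge0 h i : 0 <= dist_to (h, i).
Proof. by apply: lb_le_inf => // e []. Qed.

Lemma dist_to_lipschitz : lipschitz dist_to.
Proof.
split=> [[h i]|].
  by rewrite /= in_itv /= dist_to_ge0 ge_inf.
have le h k i e : 0 <= e -> unif_close h k e ->
    dist_to (k, i) <= dist_to (h, i) + e.
  move=> e0 hk; rewrite -lerBlDr; apply: lb_le_inf => // r [r0 rS].
  rewrite lerBlDr; apply: ge_inf => //; split; first exact: addr_ge0.
  move=> re1; have [|s Ss sh] := rS; first lra.
  by exists s => //; exact: unif_close_trans hk.
move=> h k i e e0 hk; have := le h k i e e0 hk.
have := le k h i e e0 (unif_close_sym hk); rewrite ler_norml; lra.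
Qed.

Lemma dist_to_mem i s : S i s -> dist_to (s, i) = 0.
Proof.
move=> Ss; apply/eqP; rewrite eq_le dist_to_ge0 andbT; apply: ge_inf => //.
by split=> // _; exists s => //; exact: unif_close_refl.
Qed.

Lemma dist_to_lt1 h i : dist_to (h, i) < 1 ->
  exists s e, [/\ S i s, e < 1 & unif_close s h e].
Proof.
by move=> /inf_lt[|e [_ eS] e1]//; have [s Ss sh] := eS e1; exists s, e.
Qed.

End DistanceTo.

End LipschitzFlow.

(** * From amenability to the Ramsey property *)

Section Backward.
Context (L : language) (F : fraisse_category L) (X : inv_seq F).
Context (limX : is_fraisse_limit X) (trX : transitive_limit X).
Local Notation T := (limit_quotient trX).
Local Notation q := (limit_pi trX).

(** Colourings are replaced by finite covers [col], which need not be disjoint: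
    no choice of colours is then needed when passing to limits. *)
Definition limit_ramsey_property : Prop :=
  forall (A B : obj F) d (col : 'I_d -> set (ilim X -> A)),
  (forall phi, ilim_mor_obj phi -> exists i, col i phi) ->
  exists (psi : ilim X -> B) (i : 'I_d), ilim_mor_obj psi /\
    forall h : B -> A, mor h -> exists phi, [/\ ilim_mor_obj phi, col i phi &
      forall x, adj (str A) (phi x) (h (psi x))].

(** Write each h o beta, for h in Epi(B, A), as alpha o g_h with g_h in G. A
    fixed point z in the closure of the orbit of the distances f to the colours
    takes the same value at all Phi(g_h), and some translate of f by k in Phi[G]
    is close to z at these points. If i is the colour of alpha o k, then f vanishes
    at (k, i), so f is small at (g_h k, i) for all h: the maps h o beta o k are
    all close to the colour i. *)
Lemma limit_ramsey : extremely_amenable (closure (range (@Phi L F X trX))) ->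
  limit_ramsey_property.
Proof.
move=> ea A B d col covers.
pose R : realType := Rdefinitions.R.
have [alpha malpha] := limX.1 A; have [beta mbeta] := limX.1 B.
have [u [cu uadj]] := @separating_functions R L F X trX A alpha malpha.
pose S i : set (homeo T) :=
  [set Phi trX s | s in [set s : aut X | col i (alpha \o s)]].
have [||z zcl zfix] := lipschitz_fixed_point cu _ _ (dist_to_lipschitz u S) ea.
- by exists (aut_id X) => //; exact: Phi_id.
- by move=> _ _ [g _ <-] [h _ <-]; exists (aut_comp g h) => //; exact: Phi_comp.
have lift (h : {ffun B -> A}) : {g : aut X | mor h ->
    forall x, alpha (g x) = h (beta x)}.
  apply: cid; have [mh|nh] := pselect (mor h); last by exists (aut_id X).
  have [g gE] := homogeneity limX malpha (ilim_mor_obj_comp mh mbeta).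
  by exists g.
pose g h := projT1 (lift h).
have half0 : (0 < 2^-1 :> R)%R by lra.
have [_ [[_ [k _ <-] <-] /= kz]] := zcl _ (filterI
  (filter_forall _ (fun i => nbhs_coord z (1%g, i) half0))
  (filter_forall _ (fun hi : {ffun B -> A} * 'I_d =>
     nbhs_coord z (Phi trX (g hi.1), hi.2) half0))).
case: kz => kz1 kzg.
have [i coli] := covers (alpha \o k) (ilim_mor_obj_precomp malpha (aut_mor k)).
exists (beta \o k), i; split; first exact: ilim_mor_obj_precomp (aut_mor k).
move=> h mh.
have mh' : mor (finfun h).
  by rewrite (_ : (finfun h : B -> A) = h) //; apply/funext => b; rewrite ffunE.
have gE := projT2 (lift (finfun h)) mh'.
have zg : z (Phi trX (g (finfun h)), i) = z (1%g, i).
  rewrite -{2}(zfix (Phi trX (g (finfun h)))); last by exists (g (finfun h)).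
  by rewrite /translate /= mul1g.
have k0 : dist_to u S (Phi trX k, i) = 0%R by apply: dist_to_mem; exists k.
have : (dist_to u S (Phi trX (aut_comp (g (finfun h)) k), i) < 1)%R.
  have := kz1 i; have := kzg (finfun h, i).
  rewrite /translate /= zg mul1g k0 Phi_comp.
  rewrite !ltr_norml; lra.
move=> /dist_to_lt1[_ [e [[s cols <-] e1 sh]]].
exists (alpha \o s); split=> // [|x].
  exact: ilim_mor_obj_precomp (aut_mor s).
have := gE (k x); rewrite ffunE => <-; apply: uadj => a.
by apply: le_lt_trans e1; have := sh a (q x); rewrite !PhiE.
Qed.

(** A map FF -> A receives the colour i if, along an ultrafilter, the maps
    A_n -> A through which it factors have colour i in the bad colouring at
    level n. As Epi(B, A) is finite, a solution for this limit colouring is a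
    solution at some level. *)
Lemma limit_ramsey_descent : limit_ramsey_property -> approximate_ramsey F.
Proof.
move=> lr A B d; apply: contrapT => /forallNP noC.
have bad n : {chi : epi (level X n) A -> 'I_d | forall f : epi (level X n) B,
    forall i, ~ [set epi_comp h f | h in [set: epi B A]] `<=`
                epi_thickening (chi @^-1` [set i])}.
  apply: cid; have /existsNP[chi chiP] := noC (level X n); exists chi => f i fi.
  by apply: chiP; exists f, i.
have [U [UU oU]] := ultraFilterLemma (eventually_filter).
pose col i : set (ilim X -> A) := [set phi | U [set n |
  exists2 k : epi (level X n) A, projT1 (bad n) k = i &
    forall x, phi x = k (lim_proj n x)]].
have [|psi [i [mpsi psiP]]] := lr A B d col.
  move=> phi mphi; apply: contrapT => /forallNP ncol.
  have [n0 fac] := factor_above mphi.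
  have Un0 : U [set n | n0 <= n] by apply: oU; exists n0.
  have Uall : U [set n | forall i, ~ exists2 k : epi (level X n) A,
      projT1 (bad n) k = i & forall x, phi x = k (lim_proj n x)].
    apply: filter_forall => i.
    by have [|//] := in_ultra_setVsetC [set n | exists2 k : epi (level X n) A,
      projT1 (bad n) k = i & forall x, phi x = k (lim_proj n x)]
      UU; move/(ncol i).
  have [n [n0n nall]] := filter_ex (filterI Un0 Uall).
  have [k mk kE] := fac n n0n.
  by apply: (nall (projT1 (bad n) (Epi mk))); exists (Epi mk).
have Ucap : U [set n | forall h : {ffun B -> A}, mor h ->
    exists2 k : epi (level X n) A, projT1 (bad n) k = i &
      forall x, adj (str A) (k (lim_proj n x)) (h (psi x))].
  apply: filter_forall => h; have [mh|nh] := pselect (mor h); last first.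
    by apply: filterE.
  have [phi [mphi colphi phih]] := psiP _ mh.
  apply: filterS colphi => n [k ki kE] _; exists k => // x.
  by rewrite -kE; exact: phih.
have [n0 fac] := factor_above mpsi.
have Un0 : U [set n | n0 <= n] by apply: oU; exists n0.
have [n [n0n capn]] := filter_ex (filterI Un0 Ucap).
have [f mf fE] := fac n n0n.
apply: (projT2 (bad n) (Epi mf) i) => _ [h _ <-].
have mh' : mor (finfun h).
  rewrite (_ : (finfun h : B -> A) = h); first exact: epi_mor.
  by apply/funext => b; rewrite ffunE.
have [k ki kh] := capn _ mh'; exists k => //; apply/epi_dist_le1 => c.
have [x <-] := lim_proj_surj c.
by have := kh x; rewrite ffunE fE.
Qed.

End Backward.

Theorem theorem1p1 (L : language) (F : fraisse_category L) (X : inv_seq F)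
    (limX : is_fraisse_limit X) (trX : transitive_limit X) :
  approximate_ramsey F <->
  extremely_amenable (closure (range (@Phi L F X trX))).
Proof.
have H1 : closure (range (@Phi L F X trX)) 1%g.
  by rewrite -(Phi_id trX); exact: Phi_in_closure.
split=> [arp|ea].
  apply/(extremely_amenableP H1) => K mK x y.
  have [z zP] := @ramsey_fixed_point L F X limX trX K arp.
  by rewrite (minimal_fixed_point mK zP x) (minimal_fixed_point mK zP y).
exact: limit_ramsey_descent (limit_ramsey limX ea).
Qed.
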